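(* A graph $G$ is balanceable if and only if $G$ has both a partition $V(G)=X\cup Y$ and a set of vertices $W\subseteq V(G)$ such that $e(X,Y),\,e(G[W])\in\{\lfloor\frac12 e(G)\rfloor,\lceil\frac12 e(G)\rceil\}$.
   Context: Graphs are finite and simple; $e(G)=|E(G)|$; for a partition $V(G)=X\cup Y$ (disjoint parts, possibly empty), $e(X,Y)$ is the number of edges with one end in $X$ and the other in $Y$; $G[W]$ is the subgraph induced by $W$. A $2$-coloring $E(K_n)=E(R)\cup E(B)$ is a partition of the edges of $K_n$ into red edges (forming $R$) and blue edges (forming $B$). An $(r,b)$-colored copy of $G$ (with $r+b=e(G)$) is a (not necessarily induced) subgraph of $K_n$ isomorphic to $G$ with exactly $r$ red and $b$ blue edges. A balanced copy of $G$ is an $(e(G)/2,e(G)/2)$-colored copy if $e(G)$ is even, and a copy that is either $(\lceil e(G)/2\rceil,\lfloor e(G)/2\rfloor)$-colored or $(\lfloor e(G)/2\rfloor,\lceil e(G)/2\rceil)$-colored if $e(G)$ is odd. ${\rm bal}(n,G)$ is the minimum non-negative integer $s$ such that every $2$-coloring $E(K_n)=E(R)\cup E(B)$ with $\min\{e(R),e(B)\}>s$ contains a balanced copy of $G$. The graph $G$ is balanceable if for every sufficiently large $n$ such an integer exists non-vacuously, that is, ${\rm bal}(n,G)<\lfloor\frac12\binom n2\rfloor$ (so that there are colorings with $\min\{e(R),e(B)\}>{\rm bal}(n,G)$). *)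

(* Defs.v *)
From HB Require Import structures.
From mathcomp Require Import all_boot.

Set Implicit Arguments.
Unset Strict Implicit.
Unset Printing Implicit Defensive.

Record sgraph := SGraph {
  vertex :> finType;
  adj : rel vertex;
  adj_sym : symmetric adj;
  adj_irr : irreflexive adj }.

(* Edges are unordered pairs, i.e. two-element sets of vertices. *)
Definition edges (G : sgraph) : {set {set G}} :=
  [set e : {set G} | [exists x, exists y, adj x y && (e == [set x; y])]].

Definition nedges (G : sgraph) : nat := #|edges G|.

Definition edges_between (G : sgraph) (X Y : {set G}) : {set {set G}} :=
  [set e in edges G | [exists x in X, exists y in Y, e == [set x; y]]].

Definition nedges_between (G : sgraph) (X Y : {set G}) : nat :=
  #|edges_between X Y|.

Section Induced.
Variables (G : sgraph) (W : {set G}).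

Definition induced_adj : rel {x : G | x \in W} :=
  fun x y => adj (val x) (val y).

Lemma induced_adj_sym : symmetric induced_adj.
Proof. by move=> x y; apply: adj_sym. Qed.

Lemma induced_adj_irr : irreflexive induced_adj.
Proof. by move=> x; apply: adj_irr. Qed.

Definition induced : sgraph := SGraph induced_adj_sym induced_adj_irr.

End Induced.

Section Complete.
Variable n : nat.

Definition complete_adj : rel 'I_n := fun x y => x != y.

Lemma complete_adj_sym : symmetric complete_adj.
Proof. by move=> x y; rewrite /complete_adj eq_sym. Qed.

Lemma complete_adj_irr : irreflexive complete_adj.
Proof. by move=> x; rewrite /complete_adj eqxx. Qed.

Definition complete : sgraph := SGraph complete_adj_sym complete_adj_irr.

End Complete.

(* Either color class may be empty. *)
Definition two_coloring (n : nat) (R B : {set {set complete n}}) : bool :=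
  (R :|: B == edges (complete n)) && [disjoint R & B].

(* The subgraph of K_n with vertex set S and edge set F is isomorphic to G:
   f is the isomorphism, seen as an injection with image S that carries the
   edges of G exactly onto F. The copy need not be induced, since edges of K_n
   inside S may lie outside F. *)
Definition is_copy (n : nat) (G : sgraph)
    (S : {set complete n}) (F : {set {set complete n}}) : bool :=
  [exists f : {ffun G -> complete n},
    [&& injectiveb f, S == f @: [set: G]
      & F == [set f @: (e : {set G}) | e in edges G]]].

Definition colored_copy (n : nat) (G : sgraph) (R B : {set {set complete n}})
    (r b : nat) : bool :=
  [exists S : {set complete n}, exists F : {set {set complete n}},
    [&& is_copy G S F, #|F :&: R| == r & #|F :&: B| == b]].

Definition has_balanced_copy (n : nat) (G : sgraph)
    (R B : {set {set complete n}}) : bool :=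
  let m := nedges G in
  if odd m then colored_copy G R B (uphalf m) m./2
                || colored_copy G R B m./2 (uphalf m)
  else colored_copy G R B m./2 m./2.

Definition bal_bound (n : nat) (G : sgraph) (s : nat) : bool :=
  [forall R : {set {set complete n}}, forall B : {set {set complete n}},
    two_coloring R B ==> (s < minn #|R| #|B|) ==> has_balanced_copy G R B].

(* A bound always exists, since a large s satisfies the condition vacuously. *)
Lemma bal_bound_exists (n : nat) (G : sgraph) : exists s, bal_bound n G s.
Proof.
exists #|{set complete n}|; apply/forallP => R; apply/forallP => B.
apply/implyP => _; apply/implyP.
by rewrite leq_min => /andP[]; rewrite ltnNge max_card.
Qed.

Definition bal (n : nat) (G : sgraph) : nat := ex_minn (bal_bound_exists n G).

Definition balanceable (G : sgraph) : Prop :=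
  exists N : nat, forall n : nat, N <= n -> bal n G < 'C(n, 2)./2.

(* Main.v *)
(** Suppose both colour classes have about n^2/4 edges. By the
Kovari-Sos-Turan argument each colour contains a large complete bipartite
graph. Ramsey's theorem inside its two sides gives two monochromatic cliques
joined monochromatically; unless all three colours agree this is the desired
unavoidable pattern, and if they agree for red as well as for blue, there are
a large red clique and a large blue clique, between which the bipartite Ramsey
theorem finds the pattern. A pattern whose two cliques have the same colour
hosts a balanced copy of G through the cut (X, Y), and one whose cliques have
different colours through W.

Conversely, for n = m^2 the cut with 'C(m, 2) vertices on one side contains
exactly half of the edges of K_n, and for infinitely many n (Pell's equation)
so does a clique; balanced copies of G in these two colourings give (X, Y)
and W. *)
Require Import Defs.
From mathcomp Require Import all_boot.
From mathcomp Require Import zify.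

Set Implicit Arguments.
Unset Strict Implicit.
Unset Printing Implicit Defensive.

(** * Ramsey's theorem for two-coloured cliques *)

Lemma imset_set2 (aT rT : finType) (f : aT -> rT) x y :
  f @: [set x; y] = [set f x; f y].
Proof. by rewrite imsetU !imset_set1. Qed.

Lemma exists_set_card (T : finType) k : k <= #|T| -> exists K : {set T}, #|K| = k.
Proof.
rewrite -cardsT => /card_geqP[s [us sizes _]].
by exists [set x in s]; rewrite cardsE (card_uniqP us).
Qed.

Definition clique (T : finType) (e : rel T) (c : bool) (S : {set T}) :=
  {in S &, forall x y, x != y -> e x y = c}.

Definition cross (T : finType) (e : rel T) (c : bool) (A B : {set T}) :=
  {in A & B, forall x y, e x y = c}.

Lemma cliqueS (T : finType) (e : rel T) c (A B : {set T}) :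
  A \subset B -> clique e c B -> clique e c A.
Proof. by move=> /subsetP sAB cB x y /sAB xB /sAB; apply: cB. Qed.

Lemma crossS (T : finType) (e : rel T) c (A A' B B' : {set T}) :
  A' \subset A -> B' \subset B -> cross e c A B -> cross e c A' B'.
Proof. by move=> /subsetP sA /subsetP sB cAB x y /sA xA /sB; apply: cAB. Qed.

Lemma cliqueU1 (T : finType) (e : rel T) c x (S : {set T}) :
  symmetric e -> clique e c S -> {in S, forall y, e x y = c} ->
  clique e c (x |: S).
Proof.
move=> se cS xS y z /setU1P[->|yS] /setU1P[->|zS]; rewrite ?eqxx // => yz.
- exact: xS.
- by rewrite se; apply: xS.
- exact: cS.
Qed.

(** Erdős-Szekeres recursion. A vertex [x] splits the rest of [A] by the colour of its pairs into
    [D true] and [D false]. One class is large enough for an induction hypothesis, and a clique of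
    colour [c] found in [D c] grows by [x]. The bound is the sum of the two earlier bounds plus one
    for [x]. *)
Lemma ramsey2 (a b : nat) :
  exists N, forall (T : finType) (e : rel T) (A : {set T}),
    symmetric e -> N <= #|A| ->
    exists (S : {set T}) (c : bool),
      [/\ S \subset A, clique e c S & (if c then a else b) <= #|S|].
Proof.
have triv c (T : finType) (e : rel T) : clique e c set0.
  by move=> x y; rewrite inE.
elim: a b => [|a IHa] b.
  exists 0 => T e A _ _; exists set0, true; split; rewrite ?sub0set //.
elim: b => [|b [N2 IHb]].
  exists 0 => T e A _ _; exists set0, false; split; rewrite ?sub0set //.
have [N1 {}IHa] := IHa b.+1.
exists (N1 + N2).+1 => T e A se leA.
have /card_gt0P[x xA] : 0 < #|A| by apply: leq_trans leA.
pose D (c : bool) := [set y in A :\ x | e x y == c].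
have DA c : D c \subset A.
  by apply/subsetP => y; rewrite !inE -andbA => /and3P[].
have xD c : x \notin D c by rewrite !inE eqxx.
have ext c (S : {set T}) : S \subset D c -> clique e c S ->
    [/\ x |: S \subset A, clique e c (x |: S) & #|x |: S| = #|S|.+1].
  move=> sS cS; split.
  - by rewrite subUset sub1set xA (subset_trans sS).
  - apply: cliqueU1 => // y /(subsetP sS).
    by rewrite !inE => /andP[_ /eqP].
  - rewrite cardsU1; case: (boolP (x \in S)) => // /(subsetP sS).
    by rewrite (negPf (xD c)).
have cD : #|A| = (#|D true| + #|D false|).+1.
  rewrite (cardsD1 x) xA add1n -(cardsID [set y | e x y] (A :\ x)).
  congr (_ + _).+1; apply: eq_card => y; rewrite !inE.
    by case: (e x y); rewrite ?andbT ?andbF.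
  by case: (e x y); rewrite ?andbT ?andbF.
have [le1|lt1] := leqP N1 #|D true|.
  have [S [c [sS cS leS]]] := IHa T e (D true) se le1.
  case: c cS leS => cS leS.
    have [? ? eqS] := ext _ _ sS cS.
    by exists (x |: S), true; rewrite eqS ltnS.
  by exists S, false; rewrite (subset_trans sS).
have le2 : N2 <= #|D false| by lia.
have [S [c [sS cS leS]]] := IHb T e (D false) se le2.
case: c cS leS => cS leS.
  by exists S, true; rewrite (subset_trans sS).
have [? ? eqS] := ext _ _ sS cS.
by exists (x |: S), false; rewrite eqS ltnS.
Qed.

Lemma ramsey (q : nat) :
  exists N, forall (T : finType) (e : rel T) (A : {set T}),
    symmetric e -> N <= #|A| ->
    exists (S : {set T}) (c : bool),
      [/\ S \subset A, clique e c S & q <= #|S|].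
Proof.
have [N HN] := ramsey2 q q; exists N => T e A se /(HN T e A se)[S [c]].
by rewrite if_same; exists S, c.
Qed.

(** * Complete bipartite subgraphs in dense and in two-coloured relations *)

Lemma common_neighbors (T : finType) (e : rel T) (m : nat) (A U : {set T}) :
  {in U, forall u, m <= #|[set x in A | e x u]|} ->
  m * 2 ^ #|A| <= #|U| ->
  exists A' U' : {set T},
    [/\ A' \subset A, U' \subset U, m <= #|A'|, m <= #|U'| & cross e true A' U'].
Proof.
case: (posnP m) => [-> _ _|m_gt0 degU leU].
  by exists set0, set0; split; rewrite ?sub0set // => x y; rewrite inE.
pose N u := [set x in A | e x u].
(* Pigeonhole: the vertices of [U] have at most [2 ^ #|A|] different neighbourhoods in [A], so [m]
   of them share one. Since [m > 0], some [u0] has this neighbourhood, and its degree bounds the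
   size of [S] from below. *)
have [S leS] : exists S, m <= #|[set u in U | N u == S]|.
  apply/existsP; apply: contraT; rewrite negb_exists => /forallP small.
  have: \sum_(S in powerset A) #|[set u in U | N u == S]| <=
        \sum_(S in powerset A) m.-1.
    by apply: leq_sum => S _; have := small S; rewrite -ltnNge; lia.
  rewrite sum_nat_const card_powerset.
  have -> : \sum_(S in powerset A) #|[set u in U | N u == S]| = #|U|.
    rewrite -[RHS]sum1_card (partition_big N (mem (powerset A))) /=; last first.
      by move=> u _; rewrite inE; apply/subsetP => x; rewrite inE => /andP[].
    by apply: eq_bigr => S _; rewrite -sum1_card; apply: eq_bigl => u; rewrite inE.
  have : 0 < 2 ^ #|A| by rewrite expn_gt0.
  nia.
have /card_gt0P[u0] := leq_trans m_gt0 leS.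
rewrite inE => /andP[u0U /eqP Nu0].
exists S, [set u in U | N u == S]; split=> //.
- by rewrite -Nu0; apply/subsetP => x; rewrite inE => /andP[].
- by apply/subsetP => x; rewrite inE => /andP[].
- by rewrite -Nu0; apply: degU.
- move=> x u xS; rewrite inE => /andP[_ /eqP NS].
  by move: xS; rewrite -NS inE => /andP[].
Qed.

Lemma bipartite_ramsey (t : nat) :
  exists q, forall (T : finType) (e : rel T) (A B : {set T}),
    q <= #|A| -> q <= #|B| ->
    exists (A' B' : {set T}) (c : bool),
      [/\ A' \subset A, B' \subset B, t <= #|A'|, t <= #|B'| & cross e c A' B'].
Proof.
(* The first summand provides [2t] vertices of [A]. Every vertex of [B] sees at least [t] of them in
   one colour, and the second summand leaves [t * 2 ^ t.*2] vertices of [B] with the same such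
   colour, as [common_neighbors] requires. *)
exists (t.*2 + 2 * (t * 2 ^ t.*2)) => T e A B leA leB.
have /card_geqP[s [us sizes sA]] : t.*2 <= #|A| by lia.
pose A0 := [set x in s].
have cA0 : #|A0| = t.*2 by rewrite cardsE (card_uniqP us).
have sA0 : A0 \subset A by apply/subsetP => x; rewrite inE => /sA.
pose U (c : bool) := [set u in B | t <= #|[set x in A0 | e x u == c]|].
have sU c : U c \subset B by apply/subsetP => u; rewrite inE => /andP[].
have BU : B \subset U true :|: U false.
  apply/subsetP => u uB; rewrite !inE uB /=.
  have : #|A0| = #|[set x in A0 | e x u == true]|
               + #|[set x in A0 | e x u == false]|.
    rewrite -(cardsID [set x | e x u] A0).
    congr (_ + _); apply: eq_card => y; rewrite !inE.
      by case: (e y u); rewrite ?andbT ?andbF.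
    by case: (e y u); rewrite ?andbT ?andbF.
  rewrite cA0; lia.
have [c leU] : exists c, t * 2 ^ t.*2 <= #|U c|.
  have := leq_trans (subset_leq_card BU) (leq_card_setU _ _).
  by have [|] := leqP (t * 2 ^ t.*2) #|U true|; [exists true | exists false; lia].
have [||A' [U' [sA' sU' leA' leU' cr]]] :=
    @common_neighbors T (fun x u => e x u == c) t A0 (U c).
- by move=> u; rewrite inE => /andP[].
- by rewrite cA0.
exists A', U', c; split=> //; first exact: subset_trans sA0.
- exact: subset_trans (sU c).
- by move=> x y xA yU; apply/eqP; apply: cr.
Qed.

(** Terms reaching [m] are bounded by [K], all others by [m]. A lower bound on the sum thus forces
    many terms to reach the threshold. *)
Lemma sum_threshold (I : finType) (A : {set I}) (g : I -> nat) (K m : nat) :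
  {in A, forall i, g i <= K} ->
  \sum_(i in A) g i <= #|[set i in A | m <= g i]| * K + #|A| * m.
Proof.
move=> leK; rewrite (bigID (fun i => m <= g i)) /=; apply: leq_add.
  rewrite -sum_nat_const [leqRHS](eq_bigl (fun i => (i \in A) && (m <= g i))).
    by apply: leq_sum => i /andP[/leK].
  by move=> i; rewrite inE.
rewrite -sum_nat_const [leqRHS](bigID (fun i => m <= g i)) /=.
apply: leq_trans (leq_addl _ _); apply: leq_sum => i /andP[_].
by rewrite -ltnNge; apply: ltnW.
Qed.

Lemma dense_bipartite (m : nat) :
  exists N, forall (T : finType) (e : rel T),
    N <= #|T| -> #|T| ^ 2 <= 3 * \sum_x #|[set y | e x y]| ->
    exists A B : {set T}, [/\ m <= #|A|, m <= #|B| & cross e true A B].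
Proof.
case: (posnP m) => [->|m_gt0].
  by exists 0 => T e _ _; exists set0, set0; split=> // x y; rewrite inE.
(* The density hypothesis gives [n <= 12 * #|H|] below, so the first summand yields [8 * m] vertices
   in [H]. Double counting then gives [n <= 8 * #|U|], and the second summand makes [U] large enough
   for [common_neighbors]. *)
exists (12 * (8 * m) + 8 * (m * 2 ^ (8 * m))) => T e leT dense.
set n := #|T| in leT dense.
have n_gt0 : 0 < n by lia.
pose deg x := #|[set y | e x y]|.
(* Few high-degree vertices suffice: among 8m vertices of degree at least n/4,
   a positive fraction of all vertices has m neighbours. *)
pose H := [set x in [set: T] | n <= 4 * deg x].
have leH : 8 * m <= #|H|.
  have := @sum_threshold T [set: T] (fun x => 4 * deg x) (4 * n) n.
  rewrite -big_distrr /= cardsT -/n -/H => le.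
  have {le} : 4 * (\sum_(x in [set: T]) deg x) <= #|H| * (4 * n) + n * n.
    by apply: le => x _; rewrite leq_mul2l /= max_card.
  have -> : \sum_(x in [set: T]) deg x = \sum_x deg x.
    by apply: eq_bigl => x; rewrite inE.
  move: dense; rewrite -/(deg _) expnS expn1.
  under eq_bigr do rewrite -/(deg _).
  set s := \sum_x _ => dense le.
  have : n * n <= n * (12 * #|H|) by lia.
  by rewrite leq_pmul2l //; lia.
have /card_geqP[s [us sizes sH]] := leH.
pose A := [set x in s].
have cA : #|A| = 8 * m by rewrite cardsE (card_uniqP us).
pose codeg u := #|[set x in A | e x u]|.
pose U := [set u in [set: T] | m <= codeg u].
have dc : \sum_(x in A) deg x = \sum_(u in [set: T]) codeg u.
  have E1 x : deg x = \sum_(u in [set: T]) (e x u : nat).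
    rewrite /deg -sum1_card big_mkcond [RHS]big_mkcond /=.
    by apply: eq_bigr => u _; rewrite !inE; case: (e x u).
  have E2 u : codeg u = \sum_(x in A) (e x u : nat).
    rewrite /codeg -sum1_card big_mkcond [RHS]big_mkcond /=.
    by apply: eq_bigr => x _; rewrite !inE; case: (x \in s); case: (e x u).
  under eq_bigr do rewrite E1.
  by under [RHS]eq_bigr do rewrite E2; rewrite exchange_big.
have leU : n <= 8 * #|U|.
  have lo : 8 * m * n <= 4 * \sum_(x in A) deg x.
    rewrite big_distrr /= -cA -sum_nat_const; apply: leq_sum => x.
    by rewrite inE => /sH; rewrite !inE.
  have hi : \sum_(u in [set: T]) codeg u <= #|U| * (8 * m) + n * m.
    rewrite /n -cardsT; apply: sum_threshold => u _.
    rewrite -cA; apply: subset_leq_card; apply/subsetP => x.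
    by rewrite inE => /andP[].
  rewrite -dc in hi.
  have : (4 * m) * n <= (4 * m) * (8 * #|U|) by lia.
  by rewrite leq_pmul2l //; lia.
have [||A' [U' [_ _ ? ? ?]]] := @common_neighbors T e m A U.
- by move=> u; rewrite inE => /andP[].
- rewrite cA; lia.
by exists A', U'.
Qed.

(** * The unavoidable pattern *)

Definition pattern (T : finType) (e : rel T) (t : nat)
    (A B : {set T}) (a b c : bool) :=
  [/\ [disjoint A & B], t <= #|A|, t <= #|B|,
      clique e a A & clique e b B] /\ cross e c A B.

Lemma unavoidable_pattern (t : nat) :
  exists N, forall (T : finType) (e : rel T),
    symmetric e -> N <= #|T| ->
    (forall c, #|T| ^ 2 <= 3 * \sum_x #|[set y | (x != y) && (e x y == c)]|) ->
    exists (A B : {set T}) (a b c : bool),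
      pattern e t A B a b c /\ ~~ ((a == c) && (b == c)).
Proof.
have [q0 bip] := bipartite_ramsey t.
(* The cliques must have [t] vertices to serve as sides of a pattern, and [q0] vertices for [bip]
   even after the loss of one common vertex. *)
pose q := (q0 + t).+1.
have [m ram] := ramsey q.
have [N kst] := dense_bipartite m.
exists N => T e se leN dense.
pose goal := exists (A B : {set T}) (a b c : bool),
  pattern e t A B a b c /\ ~~ ((a == c) && (b == c)).
have mono c : goal \/ exists2 P : {set T}, clique e c P & q <= #|P|.
  have [P0 [P1 [leP0 leP1 cr]]] := kst T _ leN (dense c).
  (* The relation in [dense] includes [x != y], so a vertex common to both sides would be unequal to
     itself. *)
  have dP : [disjoint P0 & P1].
    rewrite disjoint_subset; apply/subsetP => x x0; rewrite inE; apply/negP => x1.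
    by have := cr _ _ x0 x1; rewrite eqxx.
  have {}cr : cross e c P0 P1.
    by move=> x y x0 y1; have /andP[_ /eqP] := cr _ _ x0 y1.
  have [A [a [sA cA leA]]] := ram T e P0 se leP0.
  have [B [b [sB cB leB]]] := ram T e P1 se leP1.
  have [/andP[/eqP<- _]|ne] := boolP ((a == c) && (b == c)).
    by right; exists A.
  left; exists A, B, a, b, c; split=> //; split; last exact: crossS cr.
  split=> //; try by rewrite /q in leA leB; lia.
  by apply: disjointWl sA _; apply: disjointWr sB _.
have [//|[P cP leP]] := mono true.
have [//|[Q cQ leQ]] := mono false.
(* Two common vertices would form a pair of both colours. *)
have PQ : #|P :&: Q| <= 1.
  rewrite leqNgt; apply/negP => /card_gt1P[x [y [xPQ yPQ xy]]].
  move: xPQ yPQ; rewrite !inE => /andP[xP xQ] /andP[yP yQ].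
  by have := cP _ _ xP yP xy; rewrite (cQ _ _ xQ yQ xy).
have [||A [B [c [sA sB leA leB cr]]]] := bip T e (P :\: Q) Q.
- have := cardsID Q P; rewrite /q in leP; lia.
- rewrite /q in leQ; lia.
exists A, B, true, false, c; split; last by case: c cr.
split=> //; split=> //.
- apply: disjointWl sA _; apply: disjointWr sB _.
  by rewrite -setI_eq0; apply/eqP/setP => x; rewrite !inE andbAC andNb.
- by apply: cliqueS cP; apply: subset_trans sA (subsetDl _ _).
- exact: cliqueS cQ.
Qed.

(** * Counting edges, and embedding vertices into two disjoint sets *)

Section Graphs.
Variable G : sgraph.
Implicit Types (X Y W : {set G}) (x y : G).

Lemma edgesP (e : {set G}) :
  reflect (exists x y, adj x y /\ e = [set x; y]) (e \in edges G).
Proof.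
rewrite inE; apply: (iffP existsP) => [[x /existsP[y]]|[x [y [xy ->]]]].
  by move=> /andP[xy /eqP->]; exists x, y.
by exists x; apply/existsP; exists y; rewrite xy eqxx.
Qed.

Lemma adj_neq x y : adj x y -> x != y.
Proof. by apply: contraTneq => ->; rewrite adj_irr. Qed.

Lemma edges_betweenE X Y :
  edges_between X Y = [set e in edges G | e \in edges_between X Y].
Proof.
apply/setP => e; apply/idP/idP => [eX|]; last by rewrite inE => /andP[].
by rewrite inE eX andbT; move: eX; rewrite inE => /andP[].
Qed.

Lemma mem_edges_between_setC X x y : adj x y ->
  ([set x; y] \in edges_between X (~: X)) = (x \in X) (+) (y \in X).
Proof.
move=> xy; rewrite inE.
have -> /= : [set x; y] \in edges G by apply/edgesP; exists x, y.
apply/existsP/idP => [[u /andP[uX /existsP[v /andP[vX /eqP E]]]]|].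
  have : u \in [set x; y] by rewrite E set21.
  have : v \in [set x; y] by rewrite E set22.
  rewrite inE in vX.
  have uv : u != v by apply: contraNneq vX => <-.
  case/set2P => ?; case/set2P => ?; subst; rewrite ?eqxx // in uv *.
    by rewrite uX (negPf vX).
  by rewrite uX (negPf vX).
case: (boolP (x \in X)) => xX /= yX.
  by exists x; rewrite xX; apply/existsP; exists y; rewrite inE yX eqxx.
by exists y; rewrite yX; apply/existsP; exists x; rewrite inE xX setUC eqxx.
Qed.

(** The edges of [induced W] are sets over a subtype; [val] carries them injectively to edges of
    [G], where they can be compared with images under an embedding. *)
Lemma nedges_induced W : nedges (induced W) = #|[set e in edges G | e \subset W]|.
Proof.
have inj : injective (fun e : {set induced W} => val @: e).
  exact: imset_inj val_inj.
rewrite /nedges -(card_imset _ inj); apply: eq_card => e; rewrite [RHS]inE.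
apply/imsetP/andP => [[e' e'G ->]|[/edgesP[x [y [xy ->]]]]].
  split; last by apply/subsetP => _ /imsetP[u _ ->]; apply: valP.
  move: e'G; rewrite inE => /existsP[u /existsP[v /andP[uv /eqP->]]].
  by apply/edgesP; exists (val u), (val v); rewrite imset_set2.
rewrite subUset !sub1set => /andP[xW yW].
exists [set (Sub x xW : induced W); Sub y yW]; last by rewrite imset_set2.
rewrite inE; apply/existsP; exists (Sub x xW); apply/existsP; exists (Sub y yW).
by rewrite eqxx andbT /= /induced_adj.
Qed.

Lemma eq_card_edges (P Q : pred {set G}) :
  (forall x y, adj x y -> P [set x; y] = Q [set x; y]) ->
  #|[set e in edges G | P e]| = #|[set e in edges G | Q e]|.
Proof.
move=> PQ; apply: eq_card => e; rewrite inE [RHS]inE; apply: andb_id2l.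
by move=> /edgesP[x [y [xy ->]]]; apply: PQ.
Qed.

Lemma card_edge (e : {set G}) : e \in edges G -> #|e| = 2.
Proof. by move=> /edgesP[x [y [/adj_neq xy ->]]]; rewrite cards2 xy. Qed.

(** Handshake argument: every edge of [C] has two ends, so incidences are counted in two ways. *)
Lemma double_card_le_sum_deg (C : {set {set G}}) : C \subset edges G ->
  2 * #|C| <= \sum_x #|[set y | [set x; y] \in C]|.
Proof.
move=> /subsetP sC.
have -> : 2 * #|C| = \sum_x #|[set e in C | x \in e]|.
  rewrite mulnC -sum_nat_const.
  under [RHS]eq_bigr => x _ do rewrite -sum1_card.
  under [RHS]eq_bigr => x _ do
    (under eq_bigl => e do rewrite inE; rewrite big_mkcondr /=).
  rewrite exchange_big; apply: eq_bigr => e /sC /card_edge <-.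
  by rewrite -sum1_card big_mkcond.
apply: leq_sum => x _.
(* An edge at [x] is determined by its other end, because edges have two elements and so that end
   differs from [x]. *)
rewrite -[leqRHS](card_in_imset (f := fun y => [set x; y])).
  apply/subset_leq_card/subsetP => e; rewrite inE => /andP[eC xe].
  have /edgesP[u [v [_ E]]] := sC _ eC.
  move: xe; rewrite E => /set2P[xE|xE]; subst x e; apply/imsetP.
    by exists v; rewrite ?inE.
  by exists u; rewrite ?inE setUC.
move=> y z; rewrite !inE => /sC/card_edge; rewrite cards2 => xy _ E.
have : y \in [set x; z] by rewrite -E set22.
by case/set2P => // yx; rewrite yx eqxx in xy.
Qed.

(** Each of [A] and [B] alone has room for all of [G], so any choice of [Z] can be realised;
    disjointness keeps the two partial injections from colliding. *)
Lemma exists_embedding (T : finType) (A B : {set T}) (Z : {set G}) :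
  [disjoint A & B] -> #|G| <= #|A| -> #|G| <= #|B| ->
  exists2 f : G -> T, injective f &
    forall x, f x \in if x \in Z then A else B.
Proof.
move=> dAB leA leB.
pose g (C : {set T}) (le : #|G| <= #|C|) x := enum_val (widen_ord le (enum_rank x)).
have gC C le x : g C le x \in C by apply: enum_valP.
have g_inj C le : injective (g C le).
  move=> x y /enum_val_inj/(congr1 val)/= /val_inj; exact: enum_rank_inj.
exists (fun x => if x \in Z then g A leA x else g B leB x); last first.
  by move=> x; case: ifP.
have nAB x y : g A leA x <> g B leB y.
  move=> E; have := gC A leA x; rewrite E => /(disjointFr dAB).
  by rewrite gC.
by move=> x y; do 2![case: ifP => _] => [/g_inj|/nAB|/esym/nAB|/g_inj].
Qed.
End Graphs.

(** * Balanced copies and how a pattern hosts them *)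

Section Copies.
Variables (n : nat) (G : sgraph).
Implicit Types (R B : {set {set complete n}}).

Lemma two_coloringP R B : two_coloring R B ->
  forall k (x y : complete n), x != y ->
  ([set x; y] \in if k then R else B) = (([set x; y] \in R) == k).
Proof.
move=> /andP[/eqP RB dRB] k x y xy.
have : [set x; y] \in R :|: B by rewrite RB; apply/edgesP; exists x, y.
case: k; first by case: (_ \in R).
rewrite inE eqbF_neg; case: (boolP (_ \in R)) => [/(disjointFr dRB)-> //|_ /= ->//].
Qed.

Lemma imset_edge_complete (f : G -> complete n) (e : {set G}) :
  injective f -> e \in edges G -> f @: e \in edges (complete n).
Proof.
move=> fI /edgesP[x [y [/adj_neq xy ->]]]; rewrite imset_set2.
by apply/edgesP; exists (f x), (f y); split=> //; rewrite /= /complete_adj inj_eq.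
Qed.

Lemma card_copy_color (f : G -> complete n) (R : {set {set complete n}}) :
  injective f ->
  #|[set f @: (e : {set G}) | e in edges G] :&: R|
  = #|[set e in edges G | f @: e \in R]|.
Proof.
move=> fI; rewrite -(card_imset _ (imset_inj fI)); apply: eq_card => e'.
rewrite inE; apply/andP/imsetP => [[/imsetP[e eG ->] eR]|[e]].
  by exists e; rewrite // inE eG.
by rewrite inE => /andP[eG eR] ->; split=> //; apply: imset_f.
Qed.

Lemma card_copy_colors (f : G -> complete n) R B :
  two_coloring R B -> injective f ->
  #|[set e in edges G | f @: e \in R]| + #|[set e in edges G | f @: e \in B]|
  = nedges G.
Proof.
move=> /andP[/eqP RB dRB] fI.
rewrite /nedges -(cardsID [set e : {set G} | f @: e \in R] (edges G)).
have inR (e : {set G}) : (e \in [set e : {set G} | f @: e \in R]) = (f @: e \in R).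
  by rewrite inE.
congr (_ + _); apply: eq_card => e; first by rewrite inE in_setI inR.
rewrite inE in_setD inR andbC; have [eG|//] := boolP (e \in edges G).
  have := imset_edge_complete fI eG; rewrite -RB in_setU.
  case: (boolP (_ \in R)) => [/(disjointFr dRB)-> //|_ /= ->//].
by rewrite !andbF.
Qed.

(** The red and blue counts of a copy add up to [nedges G], so the red count alone decides balance
    and the case distinction on parity disappears. *)
Lemma has_balanced_copyP R B : two_coloring R B ->
  has_balanced_copy G R B <->
  exists2 f : G -> complete n, injective f &
    #|[set e in edges G | f @: e \in R]|
      \in [:: (nedges G)./2; uphalf (nedges G)].
Proof.
move=> RB.
have cc r b : colored_copy G R B r b <-> exists2 f : G -> complete n, injective f &
    #|[set e in edges G | f @: e \in R]| = r /\
    #|[set e in edges G | f @: e \in B]| = b.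
  split=> [/existsP[S /existsP[F /and3P[/existsP[f]]]]|[f fI [Er Eb]]].
    move=> /and3P[/injectiveP fI _ /eqP EF].
    by rewrite EF !card_copy_color // => /eqP Er /eqP Eb; exists f.
  have E : finfun f =1 f by move=> x; rewrite ffunE.
  have Ei (e : {set G}) : finfun f @: e = f @: e by apply: eq_imset.
  apply/existsP; exists (f @: [set: G]).
  apply/existsP; exists [set f @: (e : {set G}) | e in edges G].
  rewrite !card_copy_color // Er Eb !eqxx !andbT.
  apply/existsP; exists (finfun f); rewrite Ei eqxx /=.
  apply/andP; split; first by apply/injectiveP => x y; rewrite !E; apply: fI.
  by apply/eqP/eq_imset => e; rewrite Ei.
have hm : uphalf (nedges G) + (nedges G)./2 = nedges G.
  by rewrite uphalf_half -addnA addnn odd_double_half.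
have hu := uphalf_half (nedges G).
rewrite /has_balanced_copy; set m := nedges G in hm hu *.
split=> [|[f fI]].
  by case: ifP => _ => [/orP[]|] /cc[f fI [Er _]]; exists f;
    rewrite // Er !inE eqxx ?orbT.
have := card_copy_colors RB fI; rewrite -/m => E.
rewrite !inE => /orP[] /eqP Er; case: ifP => om; rewrite om in hu.
- by apply/orP; right; apply/cc; exists f => //; split=> //; lia.
- by apply/cc; exists f => //; split=> //; lia.
- by apply/orP; left; apply/cc; exists f => //; split=> //; lia.
- by apply/cc; exists f => //; split=> //; lia.
Qed.

(** Passing to the other colour exchanges the rounded-down and the rounded-up half. *)
Lemma has_balanced_copy_color R B (k : bool) (f : G -> complete n) :
  two_coloring R B -> injective f ->
  #|[set e in edges G | f @: e \in if k then R else B]|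
      \in [:: (nedges G)./2; uphalf (nedges G)] ->
  has_balanced_copy G R B.
Proof.
move=> RB fI; case: k => H; apply/has_balanced_copyP => //; exists f => //.
have := card_copy_colors RB fI; move: H; rewrite !inE.
have : uphalf (nedges G) + (nedges G)./2 = nedges G.
  by rewrite uphalf_half -addnA addnn odd_double_half.
lia.
Qed.

Lemma pattern_balanced R B (A1 A2 : {set complete n}) (a b c : bool)
    (X W : {set G}) :
  two_coloring R B ->
  pattern (fun x y => [set x; y] \in R) #|G| A1 A2 a b c ->
  ~~ ((a == c) && (b == c)) ->
  nedges_between X (~: X) \in [:: (nedges G)./2; uphalf (nedges G)] ->
  #|[set e in edges G | e \subset W]| \in [:: (nedges G)./2; uphalf (nedges G)] ->
  has_balanced_copy G R B.
Proof.
move=> RB [[dA le1 le2 cl1 cl2] cr] abc hX hW.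
(* Embed [Z] into [A1] and the other vertices into [A2]. The nested conditional is the colour an
   edge then receives, so [D] describes the edges that get colour [k]. *)
have key (Z : {set G}) (k : bool) (D : {set {set G}}) :
    #|[set e in edges G | e \in D]| \in [:: (nedges G)./2; uphalf (nedges G)] ->
    (forall x y, adj x y -> ([set x; y] \in D) =
      ((if x \in Z then (if y \in Z then a else c)
        else (if y \in Z then c else b)) == k)) ->
    has_balanced_copy G R B.
  move=> hD HD; have [f fI fZ] := exists_embedding Z dA le1 le2.
  apply: (@has_balanced_copy_color R B k f) => //.
  rewrite -(eq_card_edges (P := mem D)) // => x y xy.
  have xNy := adj_neq xy.
  rewrite [LHS]HD // imset_set2 (two_coloringP RB) ?inj_eq //; congr (_ == k).
  have := fZ x; have := fZ y.
  case: ifP => _ fy; case: ifP => _ fx; symmetry.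
  - by apply: cl1; rewrite ?inj_eq.
  - by rewrite setUC; apply: cr.
  - exact: cr.
  - by apply: cl2; rewrite ?inj_eq.
(* Equal cliques force [c] to be the other colour, which then appears exactly on the cut edges. *)
have [ab|ab] := eqVneq a b.
  apply: (key X c (edges_between X (~: X))); first by rewrite -edges_betweenE.
  move=> x y xy; rewrite mem_edges_between_setC // -ab.
  by move: abc; rewrite -ab; case: (x \in X); case: (y \in X); case: (a); case: (c).
have hW' : #|[set e in edges G | e \in powerset W]|
    \in [:: (nedges G)./2; uphalf (nedges G)].
  by rewrite (eq_card_edges (Q := fun e => e \subset W)) // => x y _; rewrite inE.
(* Now [a] and [b] differ and [c] equals one of them. The clique whose colour differs from [c]
   receives [W]: this is [A1] if [b = c], and [A2] otherwise, whence the complement in the last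
   case. *)
have [bc|bc] := eqVneq b c.
  apply: (key W a (powerset W)) => // x y xy.
  rewrite inE subUset !sub1set.
  by move: ab; rewrite -bc; case: (x \in W); case: (y \in W); case: (a); case: (b).
apply: (key (~: W) b (powerset W)) => // x y xy.
rewrite !inE subUset !sub1set.
by move: ab bc; case: (x \in W); case: (y \in W); case: (a); case: (b); case: (c).
Qed.
End Copies.

(** * Sufficiency of the cut and the induced subgraph *)

Lemma bal_ltP n G s : bal n G < s <-> 0 < s /\
  forall R B : {set {set complete n}},
    two_coloring R B -> s <= minn #|R| #|B| -> has_balanced_copy G R B.
Proof.
rewrite /bal; case: ex_minnP => m bm mm; split=> [lt|[s_gt0 H]].
  split=> [|R B RB le]; first by case: s lt.
  have /forallP/(_ R)/forallP/(_ B) := bm.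
  by rewrite RB (leq_trans lt le).
rewrite -(prednK s_gt0) ltnS; apply: mm.
apply/forallP => R; apply/forallP => B; apply/implyP => RB; apply/implyP.
by rewrite prednK //; apply: H.
Qed.

Lemma card_edges_complete n : #|edges (complete n)| = 'C(n, 2).
Proof.
rewrite -[n in 'C(n, 2)]card_ord -card_draws; apply: eq_card => e; rewrite [RHS]inE.
by apply/edgesP/cards2P => [[x [y [xy ->]]]|[x [y [xy ->]]]]; exists x, y.
Qed.

Lemma double_bin2 n : 2 * 'C(n, 2) = n * n.-1.
Proof. by rewrite -mul_bin_diag bin1. Qed.

Lemma balanceable_of_partitions (G : sgraph) (X W : {set G}) :
  nedges_between X (~: X) \in [:: (nedges G)./2; uphalf (nedges G)] ->
  #|[set e in edges G | e \subset W]| \in [:: (nedges G)./2; uphalf (nedges G)] ->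
  balanceable G.
Proof.
move=> hX hW; have [N HN] := unavoidable_pattern #|G|.
(* Halving with rounding loses at most one edge, so [ltC] follows from
   [n ^ 2 <= 3 * ('C(n, 2) - 1)], which holds from [n = 5] on. *)
exists (N + 5) => n len; apply/bal_ltP.
have C2 := double_bin2 n.
have ltC : n ^ 2 <= 3 * (2 * ('C(n, 2)./2)).
  have := odd_double_half 'C(n, 2).
  case: n C2 len => [|n] /=; first lia.
  move=> C2 len; nia.
split=> [|R B RB]; first by nia.
rewrite leq_min => /andP[leR leB].
have [RBE dRB] := andP RB.
have [||c|A1 [A2 [a [b [c [P abc]]]]]] :=
  HN (complete n) (fun x y => [set x; y] \in R).
- by move=> x y; rewrite setUC.
- by rewrite /= card_ord; lia.
- rewrite /= card_ord; apply: leq_trans ltC _; rewrite leq_mul2l /=.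
  (* Each colour class has at least ['C(n, 2)./2] edges, and its degree sum is at least twice its
     size. *)
  pose C := if c then R else B.
  have sC : C \subset edges (complete n).
    by rewrite -(eqP RBE) /C; case: c {C}; rewrite ?subsetUl ?subsetUr.
  apply: leq_trans (_ : 2 * #|C| <= _).
    by rewrite /C; case: (c); rewrite leq_mul2l.
  apply: leq_trans (double_card_le_sum_deg sC) _.
  apply: leq_sum => x _; apply/subset_leq_card/subsetP => y; rewrite !inE => xyC.
  have xy : x != y.
    by have := card_edge (subsetP sC _ xyC); rewrite cards2; case: eqP.
  by rewrite xy -(two_coloringP RB).
exact: pattern_balanced RB P abc hX hW.
Qed.

(** * Necessity: colourings in which each colour has exactly half of the edges *)

Lemma balanceable_halving (G : sgraph) : balanceable G ->
  exists N, forall n (R : {set {set complete n}}),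
    N <= n -> R \subset edges (complete n) -> 2 * #|R| = 'C(n, 2) ->
    exists2 f : G -> complete n, injective f &
      #|[set e in edges G | f @: e \in R]|
        \in [:: (nedges G)./2; uphalf (nedges G)].
Proof.
move=> [N HN]; exists N => n R /HN/bal_ltP[_ H] sR cR.
(* The complement of [R] also has half of the edges, so the smaller class meets the bound
   ['C(n, 2)./2] with equality, which still exceeds [bal n G]. *)
have RB : two_coloring R (edges (complete n) :\: R).
  rewrite /two_coloring -setI_eq0 setIDA setDIl setDv set0I eqxx andbT.
  by rewrite -{1}(setIidPr sR) setID.
apply/(has_balanced_copyP _ RB); apply: H => //.
rewrite cardsD (setIidPr sR) card_edges_complete -cR mul2n doubleK -addnn.
by rewrite addnK minnn.
Qed.

Lemma card_edges_between_setC n (K : {set complete n}) :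
  #|edges_between K (~: K)| = #|K| * #|~: K|.
Proof.
pose pair (p : complete n * complete n) := [set p.1; p.2].
(* A cut edge has one end in [K] and one outside, so it comes from a unique ordered pair. *)
rewrite -cardsX -(card_in_imset (f := pair)).
  apply: eq_card => e; apply/idP/imsetP => [|[[x y] /setXP[xK yK] ->]].
    rewrite inE => /andP[_ /existsP[x /andP[xK /existsP[y /andP[yK /eqP->]]]]].
    by exists (x, y); rewrite ?inE /= ?xK // -in_setC.
  rewrite (@mem_edges_between_setC (complete n) K x y).
    by rewrite xK; rewrite inE in yK.
  by rewrite /= /complete_adj; apply: contraTneq xK => ->; rewrite -in_setC.
move=> [x y] [x' y'] /setXP[xK yK] /setXP[x'K y'K].
rewrite /pair /= => E.
rewrite !in_setC in yK y'K.
have /set2P[->|xE] : x \in [set x'; y'] by rewrite -E set21.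
  have /set2P[yE|-> //] : y \in [set x'; y'] by rewrite -E set22.
  by rewrite yE x'K in yK.
by rewrite xE (negPf y'K) in xK.
Qed.

Lemma card_edges_within n (K : {set complete n}) :
  #|[set e in edges (complete n) | e \subset K]| = 'C(#|K|, 2).
Proof.
rewrite -cards_draws; apply: eq_card => e; rewrite inE [RHS]inE andbC.
congr (_ && _).
by apply/edgesP/cards2P => [[x [y [xy ->]]]|[x [y [xy ->]]]]; exists x, y.
Qed.

(* The pairs [(a.+1, b.+1)] run through the solutions of the Pell equation
   (2n - 1)^2 - 2(2k - 1)^2 = -1, multiplication by the unit 3 + 2 sqrt 2
   giving the recurrence. *)
Lemma pell_half_binomial N :
  exists n k, [/\ N <= n, k <= n & 2 * 'C(k, 2) = 'C(n, 2)].
Proof.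
suff [a [b [leN leb E]]] :
    exists a b, [/\ N <= a, b <= a & 2 * (b.+1 * b) = a.+1 * a].
  exists a.+1, b.+1; split; [exact: leqW | by [] |].
  have := double_bin2 a.+1; have := double_bin2 b.+1; rewrite /=; lia.
elim: N => [|N [a [b [leN leb E]]]]; first by exists 0, 0.
exists (3 * a + 4 * b + 3), (2 * a + 3 * b + 2); split; [lia | lia | nia].
Qed.

(** The other side of the cut has m(m+1)/2 vertices, so the product of the sides is m^2(m^2-1)/4. *)
Lemma square_half_binomial m :
  2 * ('C(m, 2) * (m ^ 2 - 'C(m, 2))) = 'C(m ^ 2, 2).
Proof.
have E1 := double_bin2 m; have E2 := double_bin2 (m ^ 2).
case: m E1 E2 => [|m] //= E1 E2.
set k := 'C(_, 2) in E1 *; set c := 'C(_, 2) in E2 *.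
have E3 : 2 * (m.+1 ^ 2 - k) = m.+1 * m.+2 by nia.
apply/eqP; rewrite -(eqn_pmul2l (_ : 0 < 2)) //; apply/eqP.
have -> : 2 * (2 * (k * (m.+1 ^ 2 - k))) = (2 * k) * (2 * (m.+1 ^ 2 - k)) by lia.
rewrite E1 E2 E3; nia.
Qed.

Theorem corollary2p5 (G : sgraph) :
  balanceable G <->
  (exists X Y : {set G},
     [/\ X :|: Y = [set: G], [disjoint X & Y]
       & nedges_between X Y \in [:: (nedges G)./2; uphalf (nedges G)]]) /\
  (exists W : {set G},
     nedges (induced W) \in [:: (nedges G)./2; uphalf (nedges G)]).
Proof.
split=> [/balanceable_halving[N HN]|[[X [Y [XY dXY hX]]] [W hW]]]; last first.
  have EY : Y = ~: X.
    apply/setP => x; rewrite inE; have := in_setT x; rewrite -XY inE.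
    by case: (boolP (x \in X)) => [/(disjointFr dXY)|].
  rewrite EY in hX; rewrite nedges_induced in hW.
  exact: balanceable_of_partitions hX hW.
split.
  pose m := N.+1; pose n := m ^ 2.
  have leNn : N <= n by rewrite /n /m; nia.
  have [K cK] : exists K : {set complete n}, #|K| = 'C(m, 2).
    apply: exists_set_card; rewrite card_ord /n.
    by have := double_bin2 m; rewrite /m /=; nia.
  have cKC : #|~: K| = m ^ 2 - 'C(m, 2) by rewrite cardsCs setCK cK card_ord.
  have [||f fI hf] := HN n (edges_between K (~: K)) leNn.
  - by apply/subsetP => e; rewrite inE => /andP[].
  - by rewrite card_edges_between_setC cK cKC square_half_binomial.
  (* An edge of [G] crosses the preimage of [K] exactly when its image crosses [K], so the red edges
     of the copy are the cut edges of [X]. *)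
  pose X := f @^-1: K; exists X, (~: X); split; first exact: setUCr.
    by rewrite disjoints_subset setCK subxx.
  rewrite /nedges_between edges_betweenE.
  rewrite (eq_card_edges (Q := fun e => f @: e \in edges_between K (~: K))) //.
  move=> x y xy.
  rewrite imset_set2 !mem_edges_between_setC ?inE //.
  by rewrite /= /complete_adj inj_eq // adj_neq.
(* Here red is a clique on [k] vertices with half of all edges; the red edges of the copy are those
   of [G] inside the preimage of [K]. *)
have [n [k [leN lek E]]] := pell_half_binomial N.
have [K cK] : exists K : {set complete n}, #|K| = k.
  by apply: exists_set_card; rewrite card_ord.
have [||f fI hf] := HN n [set e in edges (complete n) | e \subset K] leN.
- by apply/subsetP => e; rewrite inE => /andP[].
- by rewrite card_edges_within cK.
exists (f @^-1: K); rewrite nedges_induced.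
move: hf.
rewrite (eq_card_edges (Q := fun e => e \subset f @^-1: K)) // => x y xy.
rewrite inE imset_edge_complete //=; last by apply/edgesP; exists x, y.
by rewrite sub_imset_pre.
Qed.
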